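(* Let $0<\beta<1$ and let $\chi:\mathbb{R}\to\mathbb{R}$ be a kernel with $m_\beta(\chi)<+\infty$ for this $\beta$. Then for any uniformly continuous and bounded function $f:\mathbb{R}\to\mathbb{R}$ we have $$|(S_wf)(x)-f(x)|\le\omega(f,w^{-\beta})\cdot[m_\beta(\chi)+2m_0(\chi)]+2^{\beta+1}\,\|f\|_\infty\,m_\beta(\chi)\,w^{-\beta}$$ for every $x\in\mathbb{R}$ and every sufficiently large $w>0$ (i.e., there is $w_0>0$ such that the inequality holds for all $w\ge w_0$ and all $x\in\mathbb{R}$).
   Context: For $\beta\ge0$ and $\chi:\mathbb{R}\to\mathbb{R}$, the discrete absolute moment of order $\beta$ is $m_\beta(\chi):=\sup_{u\in\mathbb{R}}\sum_{k\in\mathbb{Z}}|\chi(u-k)|\,|u-k|^\beta$ (for $\beta=0$: $m_0(\chi)=\sup_{u\in\mathbb{R}}\sum_{k\in\mathbb{Z}}|\chi(u-k)|$). A function $\chi:\mathbb{R}\to\mathbb{R}$ is called a kernel if: (1) $\chi\in L^1(\mathbb{R})$ and $\chi$ is bounded on $[-1,1]$; (2) $\sum_{k\in\mathbb{Z}}\chi(u-k)=1$ for every $u\in\mathbb{R}$; (3) $m_\beta(\chi)<+\infty$ for some $\beta>0$. These conditions imply $m_0(\chi)<+\infty$. For a kernel $\chi$ and $w>0$, the sampling Kantorovich operator is $(S_wf)(x):=\sum_{k\in\mathbb{Z}}\chi(wx-k)\left[w\int_{k/w}^{(k+1)/w}f(u)\,du\right]$, $x\in\mathbb{R}$. Notation: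 $\|\cdot\|_\infty$ is the sup-norm, and the modulus of continuity is $\omega(f,\delta):=\sup\{|f(x)-f(y)|: x,y\in\mathbb{R},\ |x-y|\le\delta\}$ for $\delta>0$. *)

(* Defs.v *)
From HB Require Import structures.
From mathcomp Require Import all_boot all_order all_algebra.
From mathcomp Require Import all_classical all_reals all_analysis.

Set Implicit Arguments.
Unset Strict Implicit.
Unset Printing Implicit Defensive.

Import Order.TTheory GRing.Theory Num.Theory.
Import numFieldNormedType.Exports.

Local Open Scope classical_set_scope.
Local Open Scope ring_scope.

(* A series indexed by Z converges when its two halves, over k >= 0 and over
   k < 0, both converge; its sum is then the sum of the two halves. *)
Definition zseries_cvg (R : realType) (a : int -> R) : Prop :=
  cvgn (series (fun n : nat => a n%:Z)) /\
  cvgn (series (fun n : nat => a (- n.+1%:Z))).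

Definition zseries (R : realType) (a : int -> R) : R :=
  limn (series (fun n : nat => a n%:Z)) +
  limn (series (fun n : nat => a (- n.+1%:Z))).

(* Possibly infinite.  At beta = 0 every weight is 1, since 0 `^ 0 = 1. *)
Definition discrete_moment (R : realType) (beta : R) (chi : R -> R) : \bar R :=
  ereal_sup (range (fun u : R =>
    \esum_(k in [set: int])
      (`|chi (u - k%:~R)| * `|u - k%:~R| `^ beta)%:E)).

(* Integrability is with respect to the completed measure, so that chi is only
   required to be Lebesgue measurable (and not necessarily Borel). *)
Record is_kernel (R : realType) (chi : R -> R) : Prop := Kernel {
  kernel_L1 :
    (@completed_lebesgue_measure R).-integrable [set: R] (EFin \o chi);
  kernel_bounded : [bounded chi x | x in `[(-1 : R), 1]];
  kernel_partition : forall u : R,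
    zseries_cvg (fun k => chi (u - k%:~R)) /\
    zseries (fun k => chi (u - k%:~R)) = 1;
  kernel_moment : exists2 beta : R,
    0 < beta & (discrete_moment beta chi < +oo)%E }.

Definition sampling_kantorovich (R : realType) (chi : R -> R) (w : R)
    (f : R -> R) (x : R) : R :=
  zseries (fun k : int => chi (w * x - k%:~R) *
    (w * \int[@lebesgue_measure R]_(u in `[k%:~R / w, (k + 1)%:~R / w]) f u)).

Definition sup_norm (R : realType) (f : R -> R) : \bar R :=
  ereal_sup (range (fun x : R => `|f x|%:E)).

Definition modulus_of_continuity (R : realType) (f : R -> R) (delta : R) :
    \bar R :=
  ereal_sup [set `|f p.1 - f p.2|%:E |
    p in [set p : R * R | `|p.1 - p.2| <= delta]].

(* Main.v *)
(* As the kernel has sum 1, S_w f(x) - f(x) is the series over k of chi(wx-k)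
   times the difference between the mean of f over [k/w, (k+1)/w] and f(x).
   Put t = |wx-k|, and let u be a point of that interval.
   - If t <= w/2 then |x-u| <= 1 as soon as w >= 2, whence, beta being < 1,
     |x-u| <= |x-u|^beta <= (t+1)^beta w^-beta <= (t^beta + 1) w^-beta, so that
     |f(u)-f(x)| <= (t^beta + 2) omega(f, w^-beta).
   - If t > w/2 then 1 <= (2t/w)^beta, so that
     |f(u)-f(x)| <= 2 ||f|| <= 2^(beta+1) ||f|| w^-beta t^beta.
   Adding up both bounds against |chi(wx-k)| gives the two moments. *)
Require Import Defs.
From HB Require Import structures.
From mathcomp Require Import all_boot all_order all_algebra.
From mathcomp Require Import all_classical all_reals all_analysis.
From mathcomp Require Import ring lra.

Set Implicit Arguments.
Unset Strict Implicit.
Unset Printing Implicit Defensive.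

Import Order.TTheory GRing.Theory Num.Theory.
Import numFieldNormedType.Exports.

Local Open Scope classical_set_scope.
Local Open Scope ring_scope.

(** * Series over the integers, controlled through finite sums *)

Lemma sum_le_esum (R : realType) (T : choiceType) (a : T -> R) (s : seq T) :
  uniq s -> ((\sum_(k <- s) a k)%:E <= \esum_(k in [set: T]) (a k)%:E)%E.
Proof.
move=> us; apply: esum_ge; exists [set` s]; first by split.
by rewrite -sumEFin fsbig_seq.
Qed.

(** Each half runs along an injection from [nat], so its absolute partial sums are among the bounded
    ones and the half converges absolutely. Finite sums are the interface here because they compare
    directly with the [\esum] in the moments. *)
Lemma zseries_bound (R : realType) (a : int -> R) (M : R) :
  (forall s : seq int, uniq s -> \sum_(k <- s) `|a k| <= M) ->
  zseries_cvg a /\ `|zseries a| <= M.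
Proof.
move=> aM.
have half (g : nat -> int) : injective g -> cvgn (series (a \o g)).
  move=> ginj; apply: normed_cvg; apply: nondecreasing_is_cvgn.
    by apply: nondecreasing_series => n _ _ /=; exact: normr_ge0.
  exists M => _ [n _ <-]; have := aM [seq g i | i <- index_iota 0 n].
  by rewrite big_map map_inj_uniq// iota_uniq; exact.
have pos_inj : injective (fun n : nat => n%:Z) by move=> m n [].
have neg_inj : injective (fun n : nat => - n.+1%:Z).
  by move=> m n /oppr_inj[].
have cpos := half _ pos_inj; have cneg := half _ neg_inj.
split; first by split.
rewrite /zseries -limD// -lim_norm; last exact: is_cvgD.
apply: limr_le; first by apply: is_cvg_norm; exact: is_cvgD.
(* Initial segments of both halves form a single list without repetition; bounding the halves
   separately would cost a factor 2. *)
apply: nearW => n; set s := [seq n%:Z | n <- index_iota 0 n] ++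
  [seq - n.+1%:Z | n <- index_iota 0 n].
apply: (le_trans _ (aM s _)).
  rewrite /s big_cat !big_map /= (le_trans (ler_normD _ _))//.
  by apply: lerD; exact: ler_norm_sum.
rewrite cat_uniq !map_inj_uniq// !iota_uniq/= andbT.
by apply/hasPn => _ /mapP[i _ ->]; apply/mapP => -[j _].
Qed.

Lemma zseriesD (R : realType) (a b : int -> R) :
  zseries_cvg a -> zseries_cvg b ->
  zseries (fun k => a k + b k) = zseries a + zseries b.
Proof.
move=> [ap an] [bp bn]; rewrite /zseries.
have -> : (fun n : nat => a n%:Z + b n%:Z) =
  (fun n => a n%:Z) + (fun n => b n%:Z) by [].
have -> : (fun n : nat => a (- n.+1%:Z) + b (- n.+1%:Z)) =
  (fun n => a (- n.+1%:Z)) + (fun n => b (- n.+1%:Z)) by [].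
by rewrite !lim_seriesD// addrACA.
Qed.

Lemma zseries_cvgZ (R : realType) (a : int -> R) (c : R) :
  zseries_cvg a -> zseries_cvg (fun k => c * a k).
Proof. by move=> [ap an]; split; exact: is_cvg_seriesZ. Qed.

Lemma zseriesZ (R : realType) (a : int -> R) (c : R) :
  zseries_cvg a -> zseries (fun k => c * a k) = c * zseries a.
Proof. by move=> [ap an]; rewrite /zseries mulrDr; congr (_ + _); exact: lim_seriesZ. Qed.

(** * Powers with a real exponent *)

Lemma powRD1_le (R : realType) (t beta : R) : 0 <= t -> 0 <= beta <= 1 ->
  (t + 1) `^ beta <= t `^ beta + 1.
Proof.
move=> t0 /andP[b0 b1].
have t1 : 0 < t + 1 by rewrite ltr_wpDl.
(* With q = x / (t + 1) in [0, 1], q <= q^beta. The cases x = t and x = 1 are then added: their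
   fractions q sum to 1. *)
have le_powR (x : R) : 0 <= x <= t + 1 ->
    x / (t + 1) * (t + 1) `^ beta <= x `^ beta.
  move=> /andP[x0 xt]; have xE : x = x / (t + 1) * (t + 1).
    by rewrite divfK// gt_eqF.
  have q0 : 0 <= x / (t + 1) by rewrite divr_ge0// ltW.
  rewrite [in leRHS]xE powRM ?ler_wpM2r ?powR_ge0 ?(ltW t1)//.
  move: q0; rewrite le_eqVlt => /predU1P[<-|q0]; first exact: powR_ge0.
  rewrite ger1_powR// q0/=.
  by rewrite ler_pdivrMr ?mul1r.
have /le_powR bt : 0 <= t <= t + 1 by rewrite t0 lerDl ler01.
have /le_powR b1t : 0 <= (1 : R) <= t + 1 by rewrite ler01 lerDr.
have := lerD bt b1t.
by rewrite -mulrDl -mulrDl divff ?gt_eqF// mul1r powR1.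
Qed.

Lemma powR_div (R : realType) (a w r : R) : 0 <= a -> 0 < w ->
  (a / w) `^ r = a `^ r * w `^ (- r).
Proof.
move=> a0 w0; have aE : a `^ r = (a / w) `^ r * w `^ r.
  by rewrite -powRM ?divr_ge0 ?(ltW w0)// divfK// gt_eqF.
by rewrite aE powRN mulfK// gt_eqF// powR_gt0.
Qed.

(** * Oscillation of a function and its local means *)

Lemma unif_continuousW (U V : uniformType) (f : U -> V) :
  unif_continuous f -> continuous f.
Proof.
move=> fu x; apply/cvg_entourageP => A /fu fA.
by apply: filterS (nbhs_entourage x fA) => y /xsectionP.
Qed.

Lemma modulus_ge (R : realType) (f : R -> R) (delta x y : R) :
  `|x - y| <= delta ->
  (`|f x - f y|%:E <= modulus_of_continuity f delta)%E.
Proof. by move=> xy; apply: ereal_sup_ubound; exists (x, y). Qed.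

Lemma dist_le_chain (R : realType) (f : R -> R) (delta omega : R) (n : nat)
    (x y : R) :
  (forall x y, `|x - y| <= delta -> `|f x - f y| <= omega) ->
  `|x - y| <= n%:R * delta -> `|f x - f y| <= n%:R * omega.
Proof.
move=> fo; elim: n x y => [|n IHn] x y.
  by rewrite !mul0r !normr_le0 !subr_eq0 => /eqP ->.
(* The point [z] lies n/(n+1) of the way from [x] to [y]: the induction hypothesis covers the way to
   [z], and one step of length at most [delta] remains. *)
move=> xy; pose z := x + (y - x) * (n%:R / n.+1%:R).
have n1 : n.+1%:R != 0 :> R by rewrite pnatr_eq0.
have xz : `|x - z| <= n%:R * delta.
  have -> : x - z = (x - y) * (n%:R / n.+1%:R) by rewrite /z; ring.
  rewrite normrM [X in _ * X]ger0_norm ?divr_ge0// mulrA ler_pdivrMr ?ltr0Sn//.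
  by rewrite mulrC -mulrA ler_wpM2l// mulrC.
have zy : `|z - y| <= delta.
  have -> : z - y = (x - y) / n.+1%:R.
    by rewrite /z; field; rewrite addrC natr1.
  by rewrite normrM normfV [X in _ / X]ger0_norm// ler_pdivrMr ?ltr0Sn// mulrC.
rewrite -(subrKA (f z)) (le_trans (ler_normD _ _))// -natr1 mulrDl mul1r.
by apply: lerD; [exact: IHn|exact: fo].
Qed.

Lemma dist_le_modulus_scale (R : realType) (f : R -> R) (delta omega lambda : R)
    (x y : R) :
  0 <= delta -> 0 <= lambda ->
  (forall x y, `|x - y| <= delta -> `|f x - f y| <= omega) ->
  `|x - y| <= lambda * delta -> `|f x - f y| <= (lambda + 1) * omega.
Proof.
move=> d0 l0 fo xy; have o0 : 0 <= omega.
  by rewrite (le_trans (normr_ge0 _) (fo 0 0 _))// subrr normr0.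
have /andP[tl lt] := truncn_itv l0.
(* This number n of steps satisfies lambda < n <= lambda + 1. *)
apply: le_trans (dist_le_chain (n := (Num.truncn lambda).+1) fo _) _.
  by rewrite (le_trans xy)// ler_wpM2r// ltW.
by rewrite ler_wpM2r// -natr1 lerD2r.
Qed.

(** The integral is squeezed between those of the constants c - D and c + D, and the factor [w]
    cancels the length of the interval. *)
Lemma mean_dist_le (R : realType) (f : R -> R) (a b c D w : R) :
  0 < w -> b - a = w^-1 -> continuous f ->
  (forall u, a <= u <= b -> `|f u - c| <= D) ->
  `|w * \int[@lebesgue_measure R]_(u in `[a, b]) f u - c| <= D.
Proof.
move=> w0 ab fc fD.
have ltab : a < b by rewrite -subr_gt0 ab invr_gt0.
have intf : (@lebesgue_measure R).-integrable `[a, b] (EFin \o f).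
  apply: continuous_compact_integrable; first exact: segment_compact.
  exact: continuous_subspaceT.
have intk (k : R) : (@lebesgue_measure R).-integrable `[a, b] (EFin \o (fun _ : R => k)).
  apply: continuous_compact_integrable; first exact: segment_compact.
  by apply: continuous_subspaceT => z; exact: cvg_cst.
have cstE (k : R) : \int[@lebesgue_measure R]_(u in `[a, b]) k = k / w.
  rewrite Rintegral_cst//; congr (_ * _); rewrite -ab.
  by rewrite [X in fine X]lebesgue_measure_itv/= lte_fin ltab.
have lo : (c - D) / w <= \int[@lebesgue_measure R]_(u in `[a, b]) f u.
  rewrite -cstE; apply: (le_Rintegral _ (intk _) intf) => // u /=; rewrite in_itv/= => /fD.
  by rewrite ler_norml; lra.
have hi : \int[@lebesgue_measure R]_(u in `[a, b]) f u <= (c + D) / w.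
  rewrite -cstE; apply: (le_Rintegral _ intf (intk _)) => // u /=; rewrite in_itv/= => /fD.
  by rewrite ler_norml; lra.
move: lo hi; rewrite ler_pdivrMr// ler_pdivlMr// mulrC => lo; rewrite mulrC => hi.
by rewrite ler_norml; lra.
Qed.

Lemma kantorovich_mean_dist_le (R : realType) (beta : R) (f : R -> R)
    (w x t : R) (k : int) (omega nf : R) :
  0 < beta -> beta < 1 -> continuous f -> 2 <= w ->
  (forall x y, `|x - y| <= w `^ (- beta) -> `|f x - f y| <= omega) ->
  (forall x, `|f x| <= nf) ->
  t = `|w * x - k%:~R| ->
  `|w * \int[@lebesgue_measure R]_(u in `[k%:~R / w, (k + 1)%:~R / w]) f u
      - f x| <=
    omega * (t `^ beta + 2) + 2 `^ (beta + 1) * nf * w `^ (- beta) * t `^ beta.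
Proof.
move=> b0 b1 fc w2 fo fnf tE.
have w0 : 0 < w by rewrite (lt_le_trans _ w2).
have o0 : 0 <= omega.
  by rewrite (le_trans (normr_ge0 _) (fo 0 0 _))// subrr normr0 powR_ge0.
have nf0 : 0 <= nf by rewrite (le_trans (normr_ge0 _) (fnf 0)).
have t0 : 0 <= t by rewrite tE.
apply: mean_dist_le => //.
  by rewrite -mulrBl intrD addrAC subrr add0r mul1r.
move=> u; rewrite ler_pdivrMr// ler_pdivlMr// intrD => /andP[ku uk].
have [tw|wt] := leP t (w / 2).
  have wxu : `|w * x - w * u| <= t + 1.
    have -> : w * x - w * u = (w * x - k%:~R) + (k%:~R - w * u) by ring.
    rewrite (le_trans (ler_normD _ _))// -tE lerD2l ler_norml; lra.
  have xuE : `|x - u| = `|w * x - w * u| / w.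
    by rewrite -mulrBr normrM gtr0_norm// mulrC mulKf// gt_eqF.
  (* Here 2 <= w enters: t + 1 <= w / 2 + 1 <= w. *)
  have xu1 : `|x - u| <= 1.
    by rewrite xuE ler_pdivrMr// mul1r (le_trans wxu)//; lra.
  have xub : `|x - u| <= `|x - u| `^ beta.
    have := normr_ge0 (x - u); rewrite le_eqVlt => /predU1P[<-|xu0].
      exact: powR_ge0.
    by rewrite ger1_powR ?xu0// ltW.
  rewrite distrC.
  have xul : `|x - u| <= (t `^ beta + 1) * w `^ (- beta).
    rewrite (le_trans xub)// xuE powR_div// ler_wpM2r ?powR_ge0//.
    apply: le_trans (powRD1_le t0 _); last by rewrite (ltW b0) ltW.
    by rewrite ge0_ler_powR ?nnegrE ?(ltW b0)// addr_ge0.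
  (* Scaling with lambda = t^beta + 1 yields lambda + 1, hence the constant 2 of the statement; the
     other summand is nonnegative and is dropped. *)
  apply: le_trans (dist_le_modulus_scale _ _ fo xul) _.
  - exact: powR_ge0.
  - by rewrite addr_ge0 ?powR_ge0.
  rewrite -addrA mulrC -[leLHS]addr0 lerD//.
  by rewrite !mulr_ge0 ?powR_ge0.
have fd : `|f u - f x| <= 2 * nf.
  by rewrite (le_trans (ler_normB _ _))// mulr_natl mulr2n lerD.
rewrite (le_trans fd)// -[leLHS]add0r lerD ?mulr_ge0 ?addr_ge0 ?powR_ge0//.
have big : 1 <= 2 `^ beta * w `^ (- beta) * t `^ beta.
  rewrite mulrAC -powRM// -powR_div// ?mulr_ge0//.
  (* The left-hand 1 becomes 1^beta, so that monotonicity in the base reduces the claim to 1 <= 2t /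
     w. *)
  rewrite -[leLHS](congr1 (fun g => g beta) (powR1 R)).
  rewrite ge0_ler_powR ?nnegrE ?(ltW b0) ?divr_ge0 ?mulr_ge0 ?(ltW w0)//.
  by rewrite ler_pdivlMr//; lra.
rewrite powRD ?pnatr_eq0 ?implybT// powRr1//.
have -> : 2 `^ beta * 2 * nf * w `^ (- beta) * t `^ beta =
  (2 * nf) * (2 `^ beta * w `^ (- beta) * t `^ beta) by ring.
by rewrite ler_peMr// mulr_ge0.
Qed.

Lemma sum_moment_le (R : realType) (chi : R -> R) (beta u : R) (s : seq int) :
  uniq s ->
  ((\sum_(k <- s) (`|chi (u - k%:~R)| * `|u - k%:~R| `^ beta))%:E <=
    discrete_moment beta chi)%E.
Proof.
move=> /sum_le_esum su; apply: le_trans (su _ _) _.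
by apply: ereal_sup_ubound; exists u.
Qed.

Theorem theorem3p2 (R : realType) (beta : R) (chi : R -> R)
  (beta_gt0 : 0 < beta) (beta_lt1 : beta < 1)
  (chi_kernel : is_kernel chi)
  (chi_moment : (discrete_moment beta chi < +oo)%E)
  (f : R -> R) (f_unif_continuous : unif_continuous f)
  (f_bounded : [bounded f x | x in [set: R]]) :
  exists2 w0 : R, 0 < w0 &
    forall w x : R, w0 <= w ->
      (`|sampling_kantorovich chi w f x - f x|%:E <=
         modulus_of_continuity f (w `^ (- beta)) *
           (discrete_moment beta chi + 2%:E * discrete_moment 0 chi) +
         (2 `^ (beta + 1))%:E * sup_norm f * discrete_moment beta chi *
           (w `^ (- beta))%:E)%E.
Proof.
have fc : continuous f by exact: unif_continuousW.
have [M _ fM] := ex_strict_bound_gt0 f_bounded.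
have fMx y : `|f y| <= M by exact/ltW/fM.
exists 2 => // w x w2.
have w0 : 0 < w by rewrite (lt_le_trans _ w2).
have mod_fin : modulus_of_continuity f (w `^ (- beta)) \is a fin_num.
  rewrite ge0_fin_numE.
    apply: (@le_lt_trans _ _ (M + M)%:E); last exact: ltry.
    apply: ub_ereal_sup => _ [p _ <-]; rewrite lee_fin.
    by rewrite (le_trans (ler_normB _ _))// lerD.
  rewrite (le_trans _ (modulus_ge f (x := 0) (y := 0) _)) ?lee_fin//.
  by rewrite subrr normr0 powR_ge0.
have sup_fin : sup_norm f \is a fin_num.
  have f0 : (`|f 0|%:E <= sup_norm f)%E by apply: ereal_sup_ubound; exists 0.
  rewrite ge0_fin_numE; last by rewrite (le_trans _ f0)// lee_fin.
  apply: (@le_lt_trans _ _ M%:E); last exact: ltry.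
  by apply: ub_ereal_sup => _ [y _ <-]; rewrite lee_fin.
have fnf y : `|f y| <= fine (sup_norm f).
  by rewrite -lee_fin fineK//; apply: ereal_sup_ubound; exists y.
have fo y z : `|y - z| <= w `^ (- beta) ->
    `|f y - f z| <= fine (modulus_of_continuity f (w `^ (- beta))).
  by move=> yz; rewrite -lee_fin fineK// modulus_ge.
(* The modulus and the sup-norm are replaced by real numbers, known only through the bounds [fo] and
   [fnf]; the moments remain extended reals. *)
rewrite -(fineK mod_fin) -(fineK sup_fin).
move: (fine (modulus_of_continuity _ _)) (fine (sup_norm f)) fo fnf => omega nf fo fnf.
have o0 : 0 <= omega.
  by rewrite (le_trans (normr_ge0 _) (fo 0 0 _))// subrr normr0 powR_ge0.
have nf0 : 0 <= nf by rewrite (le_trans (normr_ge0 _) (fnf 0)).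
set RHS := (X in (_ <= X)%E).
pose a k := chi (w * x - k%:~R) *
  (w * \int[@lebesgue_measure R]_(u in `[k%:~R / w, (k + 1)%:~R / w]) f u - f x).
have aM (s : seq int) : uniq s -> ((\sum_(k <- s) `|a k|)%:E <= RHS)%E.
  move=> us.
  have Bm := sum_moment_le chi beta (w * x) us.
  have := sum_moment_le chi 0 (w * x) us.
  (* The weights of order 0 are all 1, also where wx = k. *)
  under eq_bigr do rewrite powRr0 mulr1.
  move: Bm; set B := \sum_(k <- s) _; set A := \sum_(k <- s) _ => Bm Am.
  apply: (@le_trans _ _ (omega * (B + 2 * A) +
      2 `^ (beta + 1) * nf * B * w `^ (- beta))%:E).
    (* The right-hand side is gathered into one sum over [s], to be compared term by term. *)
    rewrite lee_fin mulrDr mulrA !mulr_sumr -!big_split mulr_suml/=.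
    rewrite -big_split/=; apply: ler_sum => k _; rewrite /a normrM.
    have mk := kantorovich_mean_dist_le (x := x) (k := k) beta_gt0 beta_lt1 fc w2 fo fnf erefl.
    apply: le_trans (ler_wpM2l (normr_ge0 _) mk) _.
    by rewrite le_eqVlt; apply/orP; left; apply/eqP; ring.
  rewrite EFinD !EFinM; apply: leeD.
    by rewrite lee_wpmul2l ?lee_fin// EFinD EFinM leeD// lee_wpmul2l.
  rewrite lee_wpmul2r ?lee_fin ?powR_ge0//.
  by rewrite lee_wpmul2l// -EFinM lee_fin mulr_ge0 ?powR_ge0.
have RHS0 : (0 <= RHS)%E by have := aM [::] isT; rewrite big_nil.
(* The bound +oo is trivial and the empty sum has excluded -oo, which leaves a real bound for
   [zseries_bound]. *)
clearbody RHS; case: RHS aM RHS0 => [r aM _|_ _|//]; last exact: leey.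
have [acvg ar] := zseries_bound (fun s us => aM s us).
have [chicvg chi1] := kernel_partition chi_kernel (w * x).
(* By the partition of unity, [f x] is the sum of the convergent series of f(x) chi(wx - k), which
   is added termwise to that of [a]. *)
have -> : sampling_kantorovich chi w f x = zseries a + f x.
  rewrite -[in RHS](mulr1 (f x)) -chi1 -zseriesZ// -zseriesD//.
    by congr zseries; apply/funext => k; rewrite /a; ring.
  exact: zseries_cvgZ.
by rewrite addrK.
Qed.
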